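(* Let $G$ be a non-cyclic finite group of order $n$ and let $k$ be any fixed positive integer. Then $$\psi_k(G)\le \frac{1+3\cdot 2^k}{1+2^k+2\cdot 4^k}\,\psi_k(\mathbb{Z}_n).$$
   Context: For a finite group $G$ and a positive integer $k$, $\psi_k(G)=\sum_{g\in G} o(g)^k$, where $o(g)$ denotes the order of the element $g$. $\mathbb{Z}_n$ denotes the cyclic group of order $n$. *)

(* Defs.v *)
From mathcomp Require Import all_boot all_order all_algebra all_fingroup all_solvable.

Set Implicit Arguments.
Unset Strict Implicit.
Unset Printing Implicit Defensive.

Definition psi (gT : finGroupType) (k : nat) (G : {group gT}) : nat :=
  \sum_(g in G) #[g]%g ^ k.

(* Main.v *)
(* Let p be the largest prime divisor of n = |G|. If some x in G has order
   larger than n / p, then <x> has index less than p, hence contains a Sylow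
   p-subgroup P of G, which is cyclic, and normal because |G : N(P)| < p. Then
   G = P ><| K and, with C = C_K(P),
     psi(G) = psi(P) psi(C) + |P| (psi(K) - psi(C)),
   since an element of K outside C acts without fixed points on P, so that its
   coset modulo P is a single P-class. One concludes by induction when K is not
   cyclic, and otherwise from psi(C) <= psi(K) / (1 + 2^k).
   If all orders are at most n / p, then psi(G) <= n (n / p)^k, while
     psi(Z_n) >= n (n / M)^k  with  M = \prod_(r prime, r | n) (1 + 1/r).
   For p >= 5 one has 2 M <= p, which is enough because the constant of the
   theorem is at least 2^-k. For p = 3 and p = 2, the cyclic subgroups of
   index 3 and 2, respectively, need finer counting. *)

Require Import Defs.
From mathcomp Require Import all_boot all_order all_algebra all_fingroup all_solvable.
From mathcomp Require Import zify ring.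

Set Implicit Arguments.
Unset Strict Implicit.
Unset Printing Implicit Defensive.

Import Order.TTheory GRing.Theory Num.Theory.

(** * General properties of [psi] *)

Lemma leq_exp_base k m n : m <= n -> m ^ k <= n ^ k.
Proof. by case: k => // k; rewrite leq_exp2r. Qed.

Lemma psi_isog (aT rT : finGroupType) (G : {group aT}) (H : {group rT}) k :
  (G \isog H)%g -> psi k G = psi k H.
Proof.
case/isogP=> f injf defH; rewrite /psi -defH morphimEdom big_imset /=; last exact/injmP.
by apply: eq_bigr => g Gg; rewrite order_injm.
Qed.

Lemma psi_cyclic (gT : finGroupType) (G : {group gT}) k :
  cyclic G -> psi k G = psi k (Zp_group #|G|).
Proof.
by case/cyclicP=> x defG; apply/psi_isog; rewrite isog_sym defG; apply: Zp_isog.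
Qed.

Lemma Zp_cyclic n : cyclic (Zp n).
Proof.
by rewrite /Zp; case: ifP => _; rewrite ?cyclic1 // Zp_cycle cycle_cyclic.
Qed.

Lemma psi_ge (gT : finGroupType) (G : {group gT}) k : #|G| <= psi k G.
Proof.
by rewrite -sum1_card; apply: leq_sum => g _; rewrite expn_gt0 order_gt0.
Qed.

Lemma psi_le (gT : finGroupType) (G : {group gT}) k c d :
  {in G, forall x, #[x]%g * c <= d} -> psi k G * c ^ k <= #|G| * d ^ k.
Proof.
move=> le_o; rewrite /psi big_distrl -sum_nat_const /=.
by apply: leq_sum => g Gg; rewrite -expnMn leq_exp_base // le_o.
Qed.

Lemma psi_sub (gT : finGroupType) (G H : {group gT}) k :
  H \subset G -> psi k G = psi k H + \sum_(g in G :\: H) #[g]%g ^ k.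
Proof.
move=> sHG; rewrite /psi (bigID (mem H)) /=; congr (_ + _).
  by apply: eq_bigl => g; rewrite -in_setI (setIidPr sHG).
by apply: eq_bigl => g; rewrite inE andbC.
Qed.

Lemma psiS (gT : finGroupType) (G H : {group gT}) k :
  H \subset G -> psi k H <= psi k G.
Proof. by move/(psi_sub k)->; apply: leq_addr. Qed.

(** * Products of subgroups, and extensions of a normal cyclic p-subgroup *)

Lemma sum_order_TI_mulg (gT : finGroupType) (P K : {group gT}) k :
    (P :&: K = 1)%g ->
  \sum_(g in (P * K)%g) #[g]%g ^ k =
    \sum_(y in K) \sum_(x in P) #[(x * y)%g]%g ^ k.
Proof.
move=> tiPK; rewrite exchange_big pair_big_dep /=.
have -> : (P * K)%g = [set (u.1 * u.2)%g | u in setX P K].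
  apply/setP=> g; apply/mulsgP/imsetP=> [[x y Px Ky ->] | [[x y] /=]].
    by exists (x, y); rewrite // inE Px.
  by rewrite inE => /andP[/= Px Ky] ->; exists x y.
rewrite big_imset /=; first by apply: eq_bigl => u; rewrite inE.
move=> [x1 y1] [x2 y2] /setXP[/= Px1 Ky1] /setXP[/= Px2 Ky2] e.
have e12 : (x2^-1 * x1 = y2 * y1^-1)%g.
  by apply: (mulgI x2); apply: (mulIg y1); rewrite !mulgA mulgV mul1g mulgKV.
have : (x2^-1 * x1)%g \in (P :&: K)%g.
  by rewrite inE {2}e12 !groupM ?groupV.
rewrite tiPK => /set1P e1.
have -> : x1 = x2 by apply: (mulgI x2^-1%g); rewrite e1 mulVg.
by rewrite e1 in e12; congr pair; apply: (mulIg y1^-1%g); rewrite mulgV.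
Qed.

Lemma psi_coprime_cent (gT : finGroupType) (P K : {group gT}) k :
    K \subset 'C(P)%g -> coprime #|P| #|K| ->
  psi k (P <*> K)%G = psi k P * psi k K.
Proof.
move=> cPK coPK; rewrite /psi /= cent_joinEr // sum_order_TI_mulg ?coprime_TIg //.
rewrite mulnC big_distrl; apply: eq_bigr => y Ky /=.
rewrite big_distrr; apply: eq_bigr => x Px /=.
rewrite orderM ?expnMn 1?mulnC //; first by apply/esym/(centsP cPK).
by rewrite (coprime_dvdl (order_dvdG Px)) // (coprime_dvdr (order_dvdG Ky)).
Qed.

(* A coprime automorphism of a cyclic p-group is trivial or fixed-point-free,
   and in the latter case [P] fuses the whole coset [P y]. *)
Lemma sum_coset_cyclic_pgroup (gT : finGroupType) (P : {group gT}) (p : nat) y k :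
    (p.-group P)%g -> cyclic P -> coprime #|P| #[y]%g -> y \in 'N(P)%g ->
    y \notin 'C(P)%g ->
  \sum_(x in P) #[(x * y)%g]%g ^ k = #|P| * #[y]%g ^ k.
Proof.
move=> pP cycP coPy nPy ncPy; have abP := cyclic_abelian cycP.
have nPY : <[y]>%g \subset 'N(P)%g by rewrite cycle_subG.
have sRP : [~: P, <[y]>]%g \subset P by rewrite commg_subl.
have sCP : ('C_P(<[y]>))%g \subset P by apply: subsetIl.
have tiRC : ([~: P, <[y]>] :&: 'C_P(<[y]>) = 1)%g.
  by rewrite setIA (setIidPl sRP) coprime_abel_cent_TI.
(* The subgroups of a cyclic p-group form a chain, so one of [[~: P, <[y]>]] and ['C_P(<[y]>)],
   which meet trivially, is trivial. It cannot be the commutator, since [y] does not centralize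
   [P]. *)
have tiP : ('C_P[y] = 1)%g.
  have [a ea] := p_natP (pgroupS sRP pP); have [b eb] := p_natP (pgroupS sCP pP).
  rewrite -cent_cycle; case/orP: (leq_total b a) => leab.
    suff sCR : 'C_P(<[y]>)%g \subset [~: P, <[y]>]%g by rewrite -tiRC (setIidPr sCR).
    by rewrite -(cardSg_cyclic cycP) // ea eb dvdn_exp2l.
  case/negP: ncPy; rewrite -cycle_subG.
  have sRC : [~: P, <[y]>]%g \subset 'C_P(<[y]>)%g.
    by rewrite -(cardSg_cyclic cycP) // ea eb dvdn_exp2l.
  rewrite centsC; apply/commG1P; by rewrite -tiRC (setIidPl sRC).
have clPy : (y ^: P = P :* y)%g.
  apply/eqP; rewrite eqEcard card_rcoset -index_cent1 tiP indexg1 leqnn andbT.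
  apply/subsetP=> _ /imsetP[x Px ->]; rewrite mem_rcoset conjgE.
  have -> : (x^-1 * (y * x) * y^-1 = x^-1 * x ^ y^-1)%g.
    by rewrite conjgE invgK !mulgA.
  by rewrite groupM ?groupV // memJ_norm // groupV.
rewrite -sum_nat_const; apply: eq_bigr => x Px.
have: (x * y)%g \in (P :* y)%g by rewrite mem_rcoset mulgK.
by rewrite -clPy => /imsetP[z _ ->]; rewrite orderJ.
Qed.

(** Sum over the cosets of [P]: orders multiply on those of elements of C, and are constant on the
    others. The subtracted term is moved to the left to stay within natural numbers. *)
Lemma psi_sdprod_cyclic_pgroup (gT : finGroupType) (G P K : {group gT}) (p : nat) k :
    (P ><| K = G)%g -> (p.-group P)%g -> cyclic P -> coprime #|P| #|K| ->
  psi k G + #|P| * psi k 'C_K(P)%G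
    = psi k P * psi k 'C_K(P)%G + #|P| * psi k K.
Proof.
case/sdprodP=> _ defG nPK tiPK pP cycP coPK.
have coP y : y \in K -> coprime #|P| #[y]%g.
  by move=> Ky; rewrite (coprime_dvdr (order_dvdG Ky)).
rewrite {1}/psi -defG sum_order_TI_mulg // (bigID (mem 'C(P)%g)) /=.
have -> : \sum_(y in K | y \in 'C(P)%g) \sum_(x in P) #[(x * y)%g]%g ^ k
        = psi k P * psi k 'C_K(P)%G.
  rewrite -psi_coprime_cent ?subsetIr //; last first.
    by rewrite (coprime_dvdr _ coPK) // cardSg // subsetIl.
  rewrite /psi /= cent_joinEr ?subsetIr // sum_order_TI_mulg.
    by apply: eq_bigl => y; rewrite inE.
  by rewrite setIA tiPK; apply/trivgP; apply: subsetIl.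
rewrite -addnA; congr (_ + _).
rewrite (psi_sub k (subsetIl K 'C(P)%g)) mulnDr addnC; congr (_ + _).
rewrite big_distrr; apply: eq_big => [y|y /andP[Ky ncy]].
  by rewrite !inE; case: (y \in K); rewrite ?andbF ?andbT.
by apply: sum_coset_cyclic_pgroup pP cycP (coP y Ky) _ ncy; apply: (subsetP nPK).
Qed.

Lemma normal_cyclic_Sylow (gT : finGroupType) (G : {group gT}) (x : gT) p :
    prime p -> x \in G -> #|G| < #[x]%g * p ->
  exists P : {group gT}, [/\ p.-Sylow(G)%g P, (P <| G)%g & cyclic P].
Proof.
move=> p_pr Gx ltGxp; have sXG : <[x]>%g \subset G by rewrite cycle_subG.
have ltip : #|G : <[x]>|%g < p.
  by rewrite -(ltn_pmul2l (order_gt0 x)) /order Lagrange.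
have [P sylP] := Sylow_exists p <[x]>%G.
have [sPX pP _] := and3P sylP; have sPG := subset_trans sPX sXG.
have sylGP : p.-Sylow(G)%g P.
  rewrite /pHall sPG pP -(Lagrange_index sXG sPX) pnatM andbC.
  have [_ _ ->] := and3P sylP => /=.
  rewrite p'natE // !andbT; apply/negP=> /(dvdn_leq (indexg_gt0 _ _)).
  by rewrite leqNgt ltip.
exists P; split=> //; last exact: cyclicS sPX (cycle_cyclic x).
(* The abelian group [<[x]>] normalizes [P], so the number of Sylow p-subgroups is less than [p];
   being 1 modulo [p], it is 1. *)
rewrite /normal sPG -indexg_eq1; have lep : #|G : 'N_G(P)|%g < p.
  apply: leq_ltn_trans ltip; apply: dvdn_leq; rewrite ?indexg_gt0 //.
  apply: indexgS; rewrite subsetI sXG.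
  exact: (subset_trans (cyclic_abelian (cycle_cyclic x))
     (subset_trans (centS sPX) (cent_sub P))).
have := card_Syl_mod G p_pr; rewrite (card_Syl sylGP) modn_small // => e.
by rewrite -indexgI e.
Qed.

(** * Cyclic groups: multiplicativity and prime powers *)

Lemma psi_Zp1 k : psi k (Zp_group 1) = 1.
Proof. by rewrite /psi big_set1 order1 exp1n. Qed.

(** The cyclic group is the direct product of its Hall subgroups for the primes of [m] and for the
    other primes; these have orders [m] and [n]. *)
Lemma psi_Zp_coprime m n k : 0 < m -> 0 < n -> coprime m n ->
  psi k (Zp_group (m * n)) = psi k (Zp_group m) * psi k (Zp_group n).
Proof.
move=> m0 n0 co_mn; have mn0 : 0 < m * n by rewrite muln_gt0 m0.
set G := Zp_group (m * n); have cycG : cyclic G := Zp_cyclic _.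
have nilG := abelian_nil (cyclic_abelian cycG).
have [_ defG cRQ _] := dprodP (nilpotent_pcoreC \pi(m) nilG).
have sub pi : cyclic 'O_pi(G) by apply: cyclicS (pcore_sub _ _) cycG.
have pi_n : \pi(m)^'.-nat n by rewrite -coprime_pi'.
have cR : #|'O_\pi(m)(G)%g| = m.
  rewrite (card_Hall (nilpotent_pcore_Hall _ nilG)) card_Zp // partnM //.
  by rewrite part_pnat_id ?pnat_pi // part_p'nat ?muln1.
have cQ : #|'O_\pi(m)^'(G)%g| = n.
  rewrite (card_Hall (nilpotent_pcore_Hall _ nilG)) card_Zp // partnM //.
  by rewrite part_p'nat ?mul1n ?part_pnat_id // pnatNK pnat_pi.
have -> : G = ('O_\pi(m)(G) <*> 'O_\pi(m)^'(G))%G.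
  by apply: val_inj; rewrite /= cent_joinEr.
rewrite psi_coprime_cent ?coprime_pcoreC // (psi_cyclic k (sub _)) cR.
by rewrite (psi_cyclic k (sub _)) cQ.
Qed.

Lemma psi_Zp_dvd d n k : 0 < n -> d %| n -> psi k (Zp_group d) <= psi k (Zp_group n).
Proof.
move=> n0 dvdn; have /cyclicP[x defG] := Zp_cyclic n.
have ox : #[x]%g = n by rewrite /order -defG card_Zp.
have oH : #|<[x ^+ (n %/ d)]>%g| = d.
  rewrite -/(order _) orderXdiv ox ?dvdn_div ?divnA ?mulKn //.
have sH : (<[x ^+ (n %/ d)]> \subset Zp n)%g by rewrite defG cycleX.
have e := psi_cyclic k (cycle_cyclic (x ^+ (n %/ d))).
by rewrite oH in e; rewrite -e (psiS k (G := Zp_group n)).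
Qed.

(** The elements outside the subgroup of index [p] are exactly the generators. *)
Lemma psi_Zp_pfactor p a k : prime p ->
  psi k (Zp_group (p ^ a.+1)) =
    psi k (Zp_group (p ^ a)) + p.-1 * p ^ a * p ^ (a.+1 * k).
Proof.
move=> p_pr; have p0 := prime_gt0 p_pr; set n := p ^ a.+1.
have n0 : 0 < n by rewrite expn_gt0 p0.
have /cyclicP[x defG] := Zp_cyclic n.
have ox : #[x]%g = n by rewrite /order -defG card_Zp.
have oH : #|<[x ^+ p]>%g| = p ^ a.
  by rewrite -/(order _) orderXdiv ox /n expnS ?dvdn_mulr ?mulKn.
have sH : (<[x ^+ p]> \subset Zp_group n)%g by rewrite /= defG cycleX.
rewrite (psi_sub k sH) (psi_cyclic k (cycle_cyclic _)) /= oH; congr (_ + _).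
have cD : #|(Zp_group n :\: <[x ^+ p]>)%g| = p.-1 * p ^ a.
  by rewrite cardsD (setIidPr sH) card_Zp // oH /n expnS -subn1 mulnBl mul1n.
rewrite -cD expnM -sum_nat_const; apply: eq_bigr => g /setDP[Gg nHg].
have : #[g]%g %| p ^ a.+1 by have := order_dvdG Gg; rewrite card_Zp.
case/(dvdn_pfactor _ _ p_pr) => b leb og.
rewrite og; have -> // : b = a.+1; apply/eqP; rewrite eqn_leq leb ltnNge.
apply: contra nHg => leba; rewrite -cycle_subG.
rewrite -(cardSg_cyclic (Zp_cyclic n) _ sH) ?cycle_subG //=.
by rewrite oH -/(order g) og dvdn_exp2l.
Qed.

(** * Lower bounds for [psi] of cyclic groups *)

Lemma exp_pfactorS m a k : (m ^ a) ^ k.+1 = m ^ a * m ^ (a * k).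
Proof. by rewrite expnS expnM. Qed.

(* [(p + 1) / p] is the factor of M at the prime p. *)
Lemma psi_Zp_pfactor_ge p a k : prime p ->
  p ^ k * (p ^ a) ^ k.+1 <= psi k (Zp_group (p ^ a)) * p.+1 ^ k.
Proof.
move=> p_pr; have p0 := prime_gt0 p_pr.
(* What the induction on [a] requires: raising [a] by 1 multiplies the left side by [p ^ k.+1],
   while the new generators add [p.-1 * p.+1 ^ k] times the old left side to the right. *)
have step : p ^ k.+1 <= 1 + p.-1 * p.+1 ^ k.
  elim: k => [|k IH]; first by rewrite expn1 expn0; lia.
  rewrite expnS (expnS p.+1); nia.
elim: a => [|a IH].
  by rewrite expn0 exp1n psi_Zp1 muln1 mul1n leq_exp_base.
rewrite psi_Zp_pfactor // mulnDl.
have -> : p ^ k * (p ^ a.+1) ^ k.+1 = p ^ k * (p ^ a) ^ k.+1 * p ^ k.+1.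
  by rewrite (expnSr p a) expnMn mulnA.
have -> : p.-1 * p ^ a * p ^ (a.+1 * k) * p.+1 ^ k =
          p ^ k * (p ^ a) ^ k.+1 * (p.-1 * p.+1 ^ k).
  by rewrite mulSn expnD exp_pfactorS; ring.
apply: leq_trans (leq_mul (leqnn _) step) _.
by rewrite mulnDr muln1 leq_add2r.
Qed.

(** Only generators are counted. This is sharper than the previous bound once [k > 1]. *)
Lemma psi_Zp_pfactor_ge_totient p a k : prime p ->
  p.-1 * (p ^ a) ^ k.+1 <= psi k (Zp_group (p ^ a)) * p.
Proof.
move=> p_pr; have p0 := prime_gt0 p_pr.
case: a => [|a]; first by rewrite expn0 exp1n psi_Zp1 muln1 mul1n leq_pred.
rewrite psi_Zp_pfactor // exp_pfactorS mulnDl; apply: leq_trans (leq_addl _ _).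
by rewrite (expnSr p a); apply: eq_leq; ring.
Qed.

Lemma psi_Zp_partn n p k : 0 < n ->
  psi k (Zp_group n) = psi k (Zp_group n`_p) * psi k (Zp_group n`_p^').
Proof.
by move=> n0; rewrite -psi_Zp_coprime ?partnC // coprime_partC.
Qed.

Lemma psi_Zp_le n k : 0 < n -> psi k (Zp_group n) <= n * n ^ k.
Proof.
move=> n0; have := @psi_le _ (Zp_group n) k 1 n.
rewrite exp1n muln1 card_Zp //; apply=> g Gg; rewrite muln1.
by rewrite dvdn_leq //; have := order_dvdG Gg; rewrite card_Zp.
Qed.

(** For a prime [r] dividing [n / d], [d] divides [n / r]. Going from [r ^ a] to [r ^ a.+1] adds at
    least [r ^ k * (r ^ a) ^ k.+1], which is at least [2 ^ k] times the old value. *)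
Lemma psi_Zp_proper_dvd d n k : 0 < n -> d %| n -> d < n ->
  (1 + 2 ^ k) * psi k (Zp_group d) <= psi k (Zp_group n).
Proof.
move=> n0 /dvdnP[t nE] ltdn; have d0 : 0 < d by move: n0; rewrite nE muln_gt0 => /andP[].
have t1 : 1 < t by move: ltdn; rewrite nE; case: t {nE} => [|[|t]]; rewrite ?mul1n ?ltnn.
pose r := pdiv t; have r_pr : prime r := pdiv_prime t1.
have r1 := prime_gt1 r_pr.
have [a [u [cou e]]] : exists a u, coprime r u /\ n = r ^ a.+1 * u.
  have rn : r %| n by rewrite nE dvdn_mulr ?pdiv_dvd.
  have l0 : 0 < logn r n by rewrite logn_gt0 mem_primes r_pr n0.
  exists (logn r n).-1, n`_r^'; rewrite prednK // -p_part partnC //; split=> //.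
  rewrite (coprime_dvdl _ (coprime_partC r n n)) // p_part.
  by case: (logn r n) l0 => // b _; rewrite expnS dvdn_mulr.
have u0 : 0 < u by move: n0; rewrite e muln_gt0 => /andP[].
have ra0 b : 0 < r ^ b by rewrite expn_gt0 prime_gt0.
have dvd : d %| r ^ a * u.
  have : n = r * (r ^ a * u) by rewrite e expnS mulnA.
  rewrite nE -(divnK (pdiv_dvd t)) -/r -mulnA mulnCA => /eqP.
  by rewrite eqn_pmul2l ?prime_gt0 // => /eqP <-; apply: dvdn_mull.
have cop b : coprime (r ^ b) u by apply: coprimeXl.
apply: leq_trans (leq_mul (leqnn _) (psi_Zp_dvd k _ dvd)) _; first by rewrite muln_gt0 ra0.
rewrite e !psi_Zp_coprime // mulnA leq_mul2r; apply/orP; right.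
rewrite psi_Zp_pfactor // mulnDl mul1n leq_add2l.
have := psi_Zp_le k (ra0 a); rewrite -expnM => le.
apply: leq_trans (leq_mul (leq_exp_base k r1) le) _.
rewrite mulSn expnD; have r2 : 0 < r.-1 by lia.
apply: leq_trans (leq_pmull _ r2) _; apply: eq_leq; ring.
Qed.

(* [N / D] bounds the product of the factors [1 + 1/q] over the primes [q < p]. *)
Lemma psi_Zp_smooth_prime p N D k : prime p ->
    (forall n, 0 < n -> {in primes n, forall q, q < p} ->
       D ^ k * n ^ k.+1 <= psi k (Zp_group n) * N ^ k) ->
  forall n, 0 < n -> {in primes n, forall q, q <= p} ->
    (p * D) ^ k * n ^ k.+1 <= psi k (Zp_group n) * (p.+1 * N) ^ k.
Proof.
move=> p_pr IH n n0 le_n; rewrite (psi_Zp_partn p k n0) -{1}(partnC p n0).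
have {}IH : D ^ k * n`_p^' ^ k.+1 <= psi k (Zp_group n`_p^') * N ^ k.
  apply: IH => // q; rewrite primes_part mem_filter => /andP[q'p qn].
  by rewrite ltn_neqAle (le_n q qn) andbT.
have := leq_mul (psi_Zp_pfactor_ge (logn p n) k p_pr) IH.
rewrite -p_part !expnMn => le.
apply: leq_trans (leq_trans le _); apply: eq_leq; ring.
Qed.

Lemma psi_Zp_smooth2 n k : 0 < n -> {in primes n, forall q, q <= 2} ->
  2 ^ k * n ^ k.+1 <= psi k (Zp_group n) * 3 ^ k.
Proof.
move=> n0 le_n; apply: (@psi_Zp_smooth_prime 2 1 1 k) => // {le_n n0}n n0 lt_n.
have -> : n = 1; last by rewrite psi_Zp1 !exp1n.
have [n1|] := ltnP 1 n; last by case: n n0 {lt_n} => [|[]].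
have := lt_n (pdiv n); rewrite pi_pdiv n1 => /(_ isT).
by rewrite ltnNge prime_gt1 // pdiv_prime.
Qed.

Lemma psi_Zp_smooth3 n k : 0 < n -> {in primes n, forall q, q <= 3} ->
  n ^ k.+1 <= psi k (Zp_group n) * 2 ^ k.
Proof.
move=> n0 le_n; have := @psi_Zp_smooth_prime 3 3 2 k isT _ n n0 le_n.
rewrite -[3 * 2]/6 -[4 * 3]/(6 * 2) (expnMn 6 2) mulnCA leq_pmul2l ?expn_gt0 //.
by apply=> u u0 lt_u; apply: psi_Zp_smooth2.
Qed.

(* Telescoping: [2 = (1 + 1/2) (1 + 1/3)] times the product of all [(i + 1) / i],
   [5 <= i <= m], is [2 (m + 1) / 5]. *)
Lemma psi_Zp_smooth m n k : 4 <= m -> 0 < n -> {in primes n, forall q, q <= m} ->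
  5 ^ k * n ^ k.+1 <= psi k (Zp_group n) * (2 * m.+1) ^ k.
Proof.
elim: m n => // m IH n; rewrite leq_eqVlt => /orP[/eqP<- | m4] n0 le_n.
  (* For [m = 4] the factor [2 (m + 1) / 5] is 2, and 4 is not prime. Later, a composite [m.+1] adds
     no prime and only weakens the bound. *)
  rewrite -[2 * 5]/(5 * 2) expnMn mulnCA leq_pmul2l ?expn_gt0 //.
  apply: psi_Zp_smooth3 => // q qn; have := le_n q qn.
  by rewrite leq_eqVlt => /orP[/eqP e|//]; move: qn; rewrite e mem_primes.
have [pr|npr] := boolP (prime m.+1).
  have := @psi_Zp_smooth_prime m.+1 (2 * m.+1) 5 k pr _ n n0 le_n.
  have -> : m.+2 * (2 * m.+1) = m.+1 * (2 * m.+2) by ring.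
  rewrite !(expnMn m.+1) mulnCA -mulnA leq_pmul2l ?expn_gt0 //; apply=> u u0 lt_u.
  by apply: IH.
apply: leq_trans (IH n m4 n0 _) _; last first.
  by rewrite leq_mul2l leq_exp_base ?orbT // leq_mul2l ltnS leqnSn.
move=> q qn; have := le_n q qn; rewrite leq_eqVlt => /orP[/eqP e|//].
by move: qn; rewrite e mem_primes (negPf npr).
Qed.

(** * Groups whose element orders are all at most [n / p] *)

Lemma psi_le_sub (gT : finGroupType) (G H : {group gT}) k d :
    H \subset G -> {in G, forall x, #[x]%g <= d} ->
  psi k G <= psi k H + (#|G| - #|H|) * d ^ k.
Proof.
move=> sHG le_o; rewrite (psi_sub k sHG) leq_add2l.
have -> : #|G| - #|H| = #|G :\: H| by rewrite cardsD (setIidPr sHG).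
by rewrite -sum_nat_const; apply: leq_sum => g /setDP[Gg _]; rewrite leq_exp_base ?le_o.
Qed.

(** The constant is at least [2 ^ -k]: with [X = 2 ^ k], [X (1 + 3 X)] exceeds [1 + X + 2 X^2] by
    [X^2 - 1]. *)
Lemma bound_of_psi_exp2_le k a b : 0 < k -> a * 2 ^ k <= b ->
  a * (1 + 2 ^ k + 2 * 4 ^ k) <= (1 + 3 * 2 ^ k) * b.
Proof.
move=> k0 le; rewrite (expnMn 2 2 k); have : 2 <= 2 ^ k by rewrite -{1}(expn1 2) leq_exp2l.
move: (2 ^ k) le => X le X2.
apply: leq_trans (leq_mul (leqnn _) le); rewrite [leqRHS]mulnCA leq_mul2l; apply/orP; right; nia.
Qed.

Lemma exp3_ge k : 1 < k -> 9 * 2 ^ k <= 4 * 3 ^ k.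
Proof.
case: k => [|[|k]] // _; rewrite !expnS mulnA mulnCA.
have := leq_exp_base k (isT : 2 <= 3); lia.
Qed.

Lemma psi_bound_max_prime_ge5 (gT : finGroupType) (G : {group gT}) p k : 0 < k -> 4 < p ->
    {in primes #|G|, forall q, q <= p} -> {in G, forall x, #[x]%g * p <= #|G|} ->
  psi k G * (1 + 2 ^ k + 2 * 4 ^ k) <= (1 + 3 * 2 ^ k) * psi k (Zp_group #|G|).
Proof.
move=> k0 p4 le_p le_o; apply: bound_of_psi_exp2_le => //.
have sm := psi_Zp_smooth k (ltnW p4) (cardG_gt0 G) le_p.
have c0 : 0 < (2 * p.+1) ^ k by rewrite expn_gt0.
rewrite -(leq_pmul2r c0); apply: leq_trans sm; rewrite -mulnA -expnMn.
(* This is [2 M <= p] with M bounded by [2 (p + 1) / 5]; it amounts to [4 <= p]. *)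
have le : (2 * (2 * p.+1)) ^ k <= (5 * p) ^ k by apply: leq_exp_base; lia.
apply: leq_trans (leq_mul (leqnn _) le) _.
by rewrite expnMn mulnCA leq_mul2l expnS psi_le ?orbT.
Qed.

(** Generators make up at least [(1/2) (2/3) = 1/3] of the group. *)
Lemma psi_Zp_smooth3_totient n k : 0 < n -> {in primes n, forall q, q <= 3} ->
  n ^ k.+1 <= psi k (Zp_group n) * 3.
Proof.
move=> n0 le3; have u0 := part_gt0 2^' n.
have /p_natP[b eb] : 3.-nat n`_2^'.
  apply/(pnatP _ u0) => p p_pr p_dv.
  have : p \in primes n`_2^' by rewrite mem_primes p_pr u0.
  rewrite primes_part mem_filter => /andP[p2 /le3 p3].
  by move: p2 p3 (prime_gt1 p_pr); rewrite !inE; lia.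
have := leq_mul (psi_Zp_pfactor_ge_totient (logn 2 n) k (isT : prime 2))
  (psi_Zp_pfactor_ge_totient b k (isT : prime 3)).
rewrite -eb -p_part /= mul1n mulnACA -(psi_Zp_partn 2 k n0) mulnCA -expnMn partnC //.
by lia.
Qed.

Lemma psi_bound_3 (gT : finGroupType) (G : {group gT}) k : 0 < k ->
    {in primes #|G|, forall q, q <= 3} -> {in G, forall x, #[x]%g * 3 <= #|G|} ->
  psi k G * (1 + 2 ^ k + 2 * 4 ^ k) <= (1 + 3 * 2 ^ k) * psi k (Zp_group #|G|).
Proof.
move=> k0 le3 le_o; have n0 := cardG_gt0 G.
have := psi_le k le_o; rewrite -expnS => le_psi.
have [k1 | k1] := ltnP 1 k.
  have := psi_Zp_smooth3_totient k n0 le3.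
  have := exp3_ge k1; rewrite (expnMn 2 2 k).
  have : 4 <= 2 ^ k by rewrite -[4]/(2 ^ 2) leq_exp2l.
  move: (2 ^ k) (3 ^ k) (psi k _) (psi k _) (#|G| ^ _) le_psi => X Y b a c le1 X4 Y9 le2.
  (* The ratio of the two sums is at most [3 / 3 ^ k]; this compares it with the constant. *)
  have h : 3 * (1 + X + 2 * (X * X)) <= Y * (1 + 3 * X).
    by have := leq_mul Y9 (leqnn (1 + 3 * X)); nia.
  have le3' : a * Y <= b * 3 by lia.
  rewrite -(leq_pmul2l (isT : 0 < 3)).
  apply: (@leq_trans (a * (Y * (1 + 3 * X)))); first by rewrite mulnCA leq_mul2l h orbT.
  by have := leq_mul le3' (leqnn (1 + 3 * X)); lia.
have {k0 k1}-> : k = 1 by apply/eqP; rewrite eqn_leq k1.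
(* For [k = 1] the constant is 7/11 and [sm] gives at least [n^2 / 2] for the cyclic group, so
   orders at most [n / 4] suffice. Otherwise some [<[x]>] has index exactly 3. *)
have sm := psi_Zp_smooth3 1 n0 le3.
have [/forall_inP le4 | /forall_inPn[x Gx]] := boolP [forall x in G, #[x]%g * 4 <= #|G|].
  by have := psi_le 1 le4; move: sm; rewrite !expn1 -mulnn; lia.
rewrite -ltnNge => gt4.
have [t nE] := dvdnP (order_dvdG Gx); have o0 := order_gt0 x.
have {nE t gt4} nE : #|G| = 3 * #[x]%g.
  by rewrite nE; congr (_ * _); have := le_o x Gx; nia.
have le_ox : {in G, forall y, #[y]%g <= #[x]%g}.
  by move=> y /le_o; rewrite nE mulnC leq_pmul2l.
have [o1 | o1] := leqP #[x]%g 1.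
  have := psi_le 1 le_o; move: sm; rewrite nE !expn1 -mulnn; nia.
(* The index 3 of <[x]> alone gives only [psi 1 G <= n^2 / 3], slightly too weak;
   the subgroup generated by [x ^+ r] consists of elements of even smaller order. *)
pose r := pdiv #[x]%g; have r_pr : prime r := pdiv_prime o1.
have r3 : r <= 3.
  by apply: le3; rewrite mem_primes r_pr n0 nE dvdn_mull ?pdiv_dvd.
have [b oE] := dvdnP (pdiv_dvd #[x]%g); rewrite -/r in oE.
have oB : #|<[x ^+ r]>%g| = b.
  by rewrite -/(order _) orderXdiv ?pdiv_dvd // oE mulnK ?prime_gt0.
have sB : <[x ^+ r]>%g \subset G by rewrite cycle_subG groupX.
have b0 : 0 < b by rewrite -oB cardG_gt0.
have := psi_le_sub 1 sB le_ox; have := psi_Zp_le 1 b0.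
have := psi_cyclic 1 (cycle_cyclic (x ^+ r)); rewrite oB => ->.
move: sm; rewrite !expn1 nE oE -mulnn.
move: (psi 1 _) (psi 1 _) (psi 1 _) => f B A fE BE AE.
(* As [n = 3 r b], it remains that [b^2 (3 r^2 - r + 1) <= (7/22) (3 r b)^2], which holds for both
   values of [r]. *)
have [r2|r2] : r = 2 \/ r = 3 by have := prime_gt1 r_pr; lia.
  by rewrite r2 in fE AE; nia.
by rewrite r2 in fE AE; nia.
Qed.

(** The constant is the ratio attained by the Klein four-group, so a cyclic subgroup of index 2
    leaves no slack: both values are expanded exactly down to the cyclic group of order [n / 4]. *)
Lemma psi_bound_2 (gT : finGroupType) (G : {group gT}) k : 0 < k ->
    (2.-group G)%g -> ~~ cyclic G ->
  psi k G * (1 + 2 ^ k + 2 * 4 ^ k) <= (1 + 3 * 2 ^ k) * psi k (Zp_group #|G|).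
Proof.
move=> k0 pG ncG; have [a nE] := p_natP pG.
have ord x : x \in G -> exists2 b, #[x]%g = 2 ^ b & b < a.
  move=> Gx; have := order_dvdG Gx; rewrite nE => /(dvdn_pfactor _ _ (isT : prime 2))[b leb ob].
  exists b => //; rewrite ltn_neqAle leb andbT; apply: contra ncG => /eqP eb.
  apply/cyclicP; exists x; apply/eqP; rewrite eq_sym eqEcard cycle_subG Gx.
  by rewrite -/(order x) ob nE eb leqnn.
case: a => [|[|a]] in nE ord *; first by have [b _] := ord 1%g (group1 G).
  by case/negP: ncG; apply: prime_cyclic; rewrite nE.
have tot := psi_Zp_pfactor_ge_totient a.+2 k (isT : prime 2).
rewrite -nE mul1n in tot.
have X2 : 2 <= 2 ^ k by rewrite -{1}(expn1 2) leq_exp2l.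
have [/forall_inP le4 | /forall_inPn[x Gx]] := boolP [forall x in G, #[x]%g * 4 <= #|G|].
  have := psi_le k le4; rewrite -expnS => le.
  have := leq_trans le tot; rewrite (expnMn 2 2 k) => {}le.
  move: (2 ^ k) (psi k _) (psi k _) X2 le => X c b X2 le.
  rewrite -(leq_pmul2r (isT : 0 < 2)) -[leqRHS]mulnA.
  apply: leq_trans (leq_mul (leqnn _) le); rewrite -mulnA [leqRHS]mulnCA leq_mul2l.
  apply/orP; right; nia.
rewrite -ltnNge => gt4; have [b ob ltba] := ord x Gx.
have {gt4 ltba} ba : b = a.+1.
  apply/eqP; rewrite eqn_leq -ltnS ltba /=.
  by move: gt4; rewrite ob nE -[4]/(2 ^ 2) -expnD ltn_exp2l // addn2.
subst b.
have sH : <[x]>%g \subset G by rewrite cycle_subG.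
have le_o : {in G, forall y, #[y]%g <= 2 ^ a.+1}.
  by move=> y /ord[b -> ltb]; rewrite leq_exp2l.
have := psi_le_sub k sH le_o.
have -> : #|G| - #|<[x]>%G| = 2 ^ a.+1 by rewrite /= -/(order x) ob nE expnS; lia.
rewrite (psi_cyclic k (cycle_cyclic x)) -/(order x) ob nE (psi_Zp_pfactor a.+1 k (isT : prime 2)).
rewrite (psi_Zp_pfactor a k (isT : prime 2)) -expnM !mulSn !(expnD 2 k) (expnS 2 a) (expnMn 2 2 k).
have := @psi_Zp_le (2 ^ a) k; rewrite expn_gt0 => /(_ isT); rewrite -expnM.
move: (psi k (Zp_group (2 ^ a))) (psi k G) => F c.
move: (2 ^ a) (2 ^ (a * k)) (2 ^ k) X2 => A B X X2 FE cE.
(* The two sides of the final inequality agree at [d = 0], and their coefficients of [d] differ by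
   [2 X (X - 1)]; hence also [X = Y.+1] below. *)
have [d UE] : exists d, A * B = F + d by exists (A * B - F); lia.
have {}cE : c <= F + 3 * X * (F + d) by rewrite -UE; lia.
have [Y XE] : exists Y, X = Y.+1 by exists X.-1; lia.
rewrite XE in cE *.
apply: (@leq_trans ((F + 3 * Y.+1 * (F + d)) * (1 + Y.+1 + 2 * (Y.+1 * Y.+1)))).
  by apply: leq_mul => //; lia.
apply: (@leq_trans ((1 + 3 * Y.+1) * (F + Y.+1 * (F + d) + 2 * Y.+1 * Y.+1 * (F + d)))).
  nia.
by rewrite -UE; lia.
Qed.

(** * Groups with a normal cyclic Sylow subgroup, and the induction *)

Lemma exp2_exp3_le k : 0 < k -> 2 ^ k + 3 * (2 ^ k * 2 ^ k) <= 3 ^ k * (3 + 2 ^ k).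
Proof.
have : 2 ^ k <= 3 ^ k by apply: leq_exp_base.
(* The cases [k = 1] and [k = 2] are computed; from [k = 3] on, [3 ^ k] exceeds [3 * 2 ^ k]. *)
case: k => [|[|[|k]]] // _ _.
have := leq_exp_base k (isT : 2 <= 3); rewrite !expnS.
have : 1 <= 2 ^ k by rewrite expn_gt0.
move: (2 ^ k) (3 ^ k) => X Y X1 XY; nia.
Qed.

(** Nontrivial elements have order at least 3, and [(1 + (N - 1) 3 ^ k) / N] is smallest at
    [N = 3]. *)
Lemma psi_odd_pgroup_ge (gT : finGroupType) (P : {group gT}) (p : nat) k :
    (p.-group P)%g -> prime p -> 2 < p -> 3 <= #|P| ->
  #|P| * (1 + 2 * 3 ^ k) <= psi k P * 3.
Proof.
move=> pP p_pr p3 P3.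
have : 1 + #|P|.-1 * 3 ^ k <= psi k P.
  rewrite /psi (bigD1 1%g) ?group1 //= order1 exp1n leq_add2l.
  have -> : #|P|.-1 = #|P^#%g| by rewrite (cardsD1 1%g P) group1.
  rewrite -sum_nat_const; under eq_bigl => g do rewrite inE in_set1 andbC.
  apply: leq_sum => g /andP[Pg g1]; apply/leq_exp_base/(leq_trans p3).
  have [b ob] := p_natP (mem_p_elt pP Pg); move: g1; rewrite -order_eq1 ob.
  by case: b {ob} => // b _; rewrite expnS leq_pmulr // expn_gt0 prime_gt0.
case: #|P| P3 => // n P3 /=; have : 0 < 3 ^ k by rewrite expn_gt0.
move: (3 ^ k) (psi k P) => Y c Y0; nia.
Qed.

Lemma psi_bound_sdprod_cyclic (gT : finGroupType) (G P K : {group gT}) (p : nat) k :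
    0 < k -> (P ><| K = G)%g -> (p.-group P)%g -> cyclic P -> coprime #|P| #|K| ->
    prime p -> 2 < p -> 3 <= #|P| -> cyclic K -> ~~ cyclic G ->
  psi k G * (1 + 2 ^ k + 2 * 4 ^ k) <= (1 + 3 * 2 ^ k) * (psi k P * psi k K).
Proof.
move=> k0 defG pP cycP coPK p_pr p3 P3 cycK ncG.
have psiG := psi_sdprod_cyclic_pgroup k defG pP cycP coPK.
have psiP := psi_odd_pgroup_ge k pP p_pr p3 P3.
have psiPge := psi_ge P k.
have psiC : (1 + 2 ^ k) * psi k 'C_K(P)%G <= psi k K.
  have cycC : cyclic 'C_K(P)%g by apply: cyclicS (subsetIl _ _) cycK.
  rewrite (psi_cyclic k cycC) (psi_cyclic k cycK) psi_Zp_proper_dvd ?cardSg ?subsetIl //.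
  rewrite proper_card // properE subsetIl subsetI subxx /=; apply: contra ncG => cPK.
  by have [_ <- _ _] := sdprodP defG; apply: cyclicM.
have := exp2_exp3_le k0; rewrite (expnMn 2 2 k).
have : 1 <= 2 ^ k by rewrite expn_gt0.
move: (2 ^ k) (3 ^ k) (psi k G) (psi k P) (psi k K) (psi k 'C_K(P)%G) #|P| psiG psiP psiPge psiC.
move=> X Y g s t c a eqg les leas lec X1 XY.
(* Since [G] is not cyclic, C is proper in [K], whence [lec]. It eliminates [c] here, and [les] then
   eliminates [a] in [g2]. *)
have g1 : (1 + X) * g <= s * t + a * X * t.
  have [d sE] : exists d, s = a + d by exists (s - a); lia.
  have {}eqg : g = d * c + a * t by move: eqg; rewrite sE; lia.
  have := leq_mul (leqnn d) lec; rewrite eqg sE; lia.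
have g2 : (1 + X) * (1 + 2 * Y) * g <= s * t * (1 + 2 * Y + 3 * X).
  have := leq_mul (leqnn (1 + 2 * Y)) g1; have := leq_mul les (leqnn (X * t)); lia.
have c0 : 0 < (1 + X) * (1 + 2 * Y) by [].
rewrite -(leq_pmul2l c0).
have -> : (1 + X) * (1 + 2 * Y) * (g * (1 + X + 2 * (X * X))) =
  (1 + X) * (1 + 2 * Y) * g * (1 + X + 2 * (X * X)) by rewrite mulnA.
apply: leq_trans (leq_mul g2 (leqnn _)) _.
have -> : (1 + X) * (1 + 2 * Y) * ((1 + 3 * X) * (s * t)) =
  s * t * ((1 + X) * (1 + 2 * Y) * (1 + 3 * X)) by ring.
rewrite -mulnA leq_mul2l; apply/orP; right.
(* After expansion, the remaining inequality is [XY] multiplied by [2 * X]. *)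
have := leq_mul (leqnn (2 * X)) XY; lia.
Qed.

Lemma psi_noncyclic (gT : finGroupType) (G : {group gT}) k : 0 < k -> ~~ cyclic G ->
  psi k G * (1 + 2 ^ k + 2 * 4 ^ k) <= (1 + 3 * 2 ^ k) * psi k (Zp_group #|G|).
Proof.
move=> k0; have [m] := ubnP #|G|; elim: m G => // m IH G /ltnSE-leGm ncG.
have n0 := cardG_gt0 G; pose p := max_pdiv #|G|.
have n1 : 1 < #|G|.
  by rewrite cardG_gt1; apply: contra ncG => /eqP->; apply: cyclic1.
have p_pr : prime p := max_pdiv_prime n1.
have le_p : {in primes #|G|, forall q, q <= p} by move=> q; apply: max_pdiv_max.
have [p2 | p2] := leqP p 2.
  apply: psi_bound_2 => //; apply/(pnatP _ n0) => q q_pr q_dv.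
  have : q <= 2 by apply: leq_trans (le_p q _) p2; rewrite mem_primes q_pr n0.
  by rewrite !inE eqn_leq prime_gt1 // => ->.
have [/forall_inP le_o | /forall_inPn[x Gx]] := boolP [forall x in G, #[x]%g * p <= #|G|].
  have [p4 | p4] := ltnP 4 p; first by apply: psi_bound_max_prime_ge5 p4 le_p le_o.
  have p3 : p = 3.
    have : p = 3 \/ p = 4 by lia.
    by case=> // e; move: p_pr; rewrite e.
  by rewrite p3 in le_p le_o; apply: psi_bound_3.
rewrite -ltnNge => /(normal_cyclic_Sylow p_pr Gx)[P [sylP nsPG cycP]].
have [K] := splitsP (SchurZassenhaus_split (pHall_Hall sylP) nsPG).
case/complP=> tiPK defPK.
have nPK : K \subset 'N(P)%g.
  by apply: subset_trans (normal_norm nsPG); rewrite -defPK mulG_subr.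
have defG : (P ><| K = G)%g by rewrite sdprodE.
have pP := pHall_pgroup sylP.
have coPK : coprime #|P| #|K|.
  by rewrite (coprime_sdprod_Hall_l defG) (pHall_Hall sylP).
have P3 : 3 <= #|P|.
  rewrite (leq_trans p2) // (card_Hall sylP) p_part -{1}(expn1 p) leq_exp2l ?prime_gt1 //.
  by rewrite logn_gt0 pi_max_pdiv.
have cG := sdprod_card defG.
have -> : psi k (Zp_group #|G|) = psi k P * psi k (Zp_group #|K|).
  by rewrite -cG psi_Zp_coprime // (psi_cyclic k cycP).
have [cycK | ncK] := boolP (cyclic K).
  rewrite -(psi_cyclic k cycK).
  exact: psi_bound_sdprod_cyclic k0 defG pP cycP coPK p_pr p2 P3 cycK ncG.
have /IH/(_ ncK) IHK : #|K| < m.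
  by apply: leq_trans leGm; rewrite -cG ltn_Pmull // (leq_trans _ P3).
have psiG := psi_sdprod_cyclic_pgroup k defG pP cycP coPK.
have psiP := psi_ge P k; have psiC : psi k 'C_K(P)%G <= psi k K by apply: psiS (subsetIl _ _).
(* The difference of the two sides is [(psi(P) - |P|) (psi(K) - psi(C))]. *)
have leG : psi k G <= psi k P * psi k K.
  move: psiG psiP psiC; move: (psi k G) (psi k P) (psi k K) (psi k 'C_K(P)%G) #|P|.
  move=> g s t c a eqg /subnK sE /subnK tE; rewrite -sE -tE in eqg *.
  by move: (s - a) (t - c) eqg => d e; nia.
apply: leq_trans (leq_mul leG (leqnn _)) _.
by rewrite -mulnA [leqRHS]mulnCA leq_mul2l IHK orbT.
Qed.

Local Open Scope ring_scope.

Theorem theorem1p6 (gT : finGroupType) (G : {group gT}) (n k : nat)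
    (hn : #|G| = n) (hG : ~~ cyclic G) (hk : (0 < k)%N) :
  (psi k G)%:R <= (1 + 3 * 2 ^+ k) / (1 + 2 ^+ k + 2 * 4 ^+ k)
                  * (psi k (Zp_group n))%:R :> rat.
Proof.
rewrite -hn -!natrX -!natrM -!(natrD _ 1) -natrD mulrAC ler_pdivlMr ?ltr0n //.
by rewrite -!natrM ler_nat psi_noncyclic.
Qed.
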